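(* Consider the normal means model $y=\beta+\varepsilon$, $\varepsilon\sim N(0,I_n)$, $\beta\in\mathcal B(n,s_n)$, with $\limsup_n s_n/n=\zeta\in[0,1)$. Let $c_1\ge2$ be a constant and suppose $\Omega_o(c_1)$ is nonempty. Then, as $n\to\infty$: (i) if $\lim_n s_n/n>0$, then $$\inf_{\widehat\beta\in\Omega_o(c_1)}\ \sup_{\beta\in\mathcal B(n,s_n)}E_\beta[\mathrm{FP}(\widehat\beta)]\asymp n;$$ (ii) if $\lim_n s_n/n=0$, then there is a real sequence $\delta_n\to0$ such that $$\inf_{\widehat\beta\in\Omega_o(c_1)}\ \sup_{\beta\in\mathcal B(n,s_n)}E_\beta[\mathrm{FP}(\widehat\beta)]\asymp n\,(s_n/n)^{(c_1+\delta_n)/2}.$$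
   Context: $1\le s_n\le n$ are integers. $\mathcal B(n,s_n)=\{\beta\in\mathbb R^n:\|\beta\|_0\le s_n\}$, where $\|\beta\|_0$ is the number of nonzero entries. An estimator is any (measurable) function $\widehat\beta=\widehat\beta(y)\in\mathbb R^n$; it is allowed to depend on $s_n$. $E_\beta$ is expectation over $y\sim N(\beta,I_n)$. $\mathrm{FP}(\widehat\beta)=|\{j:\widehat\beta_j\ne0,\ \beta_j=0\}|$. The class of rate optimal estimators with multiplicative constant $c_1$ is $$\Omega_o(c_1)=\Big\{\widehat\beta:\ \sup_{\beta\in\mathcal B(n,s_n)}E_\beta\|\beta-\widehat\beta\|^2\le c_1s_n\log(n/s_n)\Big\}.$$ For positive sequences, $a_n\asymp b_n$ means $0<\liminf a_n/b_n\le\limsup a_n/b_n<\infty$. *)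

(* Defs.v *)
From HB Require Import structures.
From mathcomp Require Import all_boot all_order all_algebra.
From mathcomp Require Import all_classical all_reals all_analysis.
Set Implicit Arguments.
Unset Strict Implicit.
Unset Printing Implicit Defensive.
Import Order.TTheory GRing.Theory Num.Theory.
Import numFieldNormedType.Exports.
Local Open Scope classical_set_scope.
Local Open Scope ring_scope.

Section normal_means.
Context {R : realType}.

(* R^n is n.-tuple R, with the library's product Borel sigma-algebra. *)

(* normal_prob lives on measurableTypeR R, the same Borel sigma-algebra as the
   canonical one on R but with another display. *)
Definition consp n (p : measurableTypeR R * n.-tuple R) : n.+1.-tuple R :=
  [tuple of (p.1 : R) :: p.2].

Lemma measurable_consp n :
  measurable_fun [set: measurableTypeR R * n.-tuple R] (@consp n).
Proof. exact: measurable_cons. Qed.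

HB.instance Definition _ n :=
  isMeasurableFun.Build _ _ _ _ (@consp n) (@measurable_consp n).

(* N(b, I_n), as the product of the laws N(b_i, 1). *)
Fixpoint gaussian n : n.-tuple R -> probability (n.-tuple R) R :=
  match n with
  | 0 => fun=> \d_([tuple])
  | n'.+1 => fun b =>
      distribution
        (normal_prob (thead b) 1 \x
           gaussian ([tuple of behead b] : n'.-tuple R))%E
        (@consp n')
  end.

Lemma gaussian_box n (b : n.-tuple R) (A : 'I_n -> set R) :
  (forall i, measurable (A i)) ->
  gaussian b [set y | forall i, A i (tnth y i)] =
  (\prod_(i < n) normal_prob (tnth b i) 1 (A i))%E.
Proof.
elim: n b A => [|n IH] b A mA /=.
  rewrite big_ord0 diracE mem_set//= => -[]//.
rewrite big_ord_recl /distribution /pushforward.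
rewrite (_ : _ @^-1` _ = A ord0 `*`
  [set y : n.-tuple R | forall i, A (lift ord0 i) (tnth y i)]); last first.
  apply/seteqP; split => -[x y] /=.
    move=> H; split; first exact: (H ord0).
    by move=> i; have := H (lift ord0 i); rewrite /consp /= tnthS.
  move=> [Hx Hy] i; case: (unliftP ord0 i) => [j ->|->]//.
  by rewrite /consp /= tnthS.
rewrite product_measure1E//; last first.
  rewrite (_ : [set _ | _] = \bigcap_(i in [set: 'I_n])
      ((@tnth n R ^~ i) @^-1` A (lift ord0 i))); last first.
    by apply/seteqP; split => y /= H i; [move=> _; exact: H|exact: (H i I)].
  apply: fin_bigcap_measurable => //= i _.
  by rewrite -[X in measurable X]setTI; exact: measurable_tnth.
  exact: (mA ord0).
congr (_ * _)%E.
rewrite [LHS](IH [tuple of behead b] (fun i => A (lift ord0 i)))//; apply: eq_bigr => i _.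
by congr (normal_prob _ _ _); rewrite [in RHS](tuple_eta b) tnthS.
Qed.

Definition l0norm n (b : n.-tuple R) : nat := #|[pred i | tnth b i != 0]|.

Definition sparse_ball n (s : nat) : set (n.-tuple R) :=
  [set b | (l0norm b <= s)%N].

Definition sqdist n (a b : n.-tuple R) : R :=
  \sum_(i < n) (tnth a i - tnth b i) ^+ 2.

Definition FP n (b bhat : n.-tuple R) : nat :=
  #|[pred j | (tnth bhat j != 0) && (tnth b j == 0)]|.

Definition max_risk n (s : nat) (bhat : n.-tuple R -> n.-tuple R) : \bar R :=
  (ereal_sup
    [set 'E_(gaussian b)[fun y => sqdist b (bhat y)]
    | b in @sparse_ball n s])%E.

Definition max_FP n (s : nat) (bhat : n.-tuple R -> n.-tuple R) : \bar R :=
  (ereal_sup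
    [set 'E_(gaussian b)[fun y => (FP b (bhat y))%:R%R]
    | b in @sparse_ball n s])%E.

Definition Omega_o n (s : nat) (c1 : R) : set (n.-tuple R -> n.-tuple R) :=
  [set bhat | measurable_fun [set: n.-tuple R] bhat /\
    (max_risk s bhat <= (c1 * s%:R * ln (n%:R / s%:R))%:E)%E].

Definition minimax_FP n (s : nat) (c1 : R) : \bar R :=
  ereal_inf [set max_FP s bhat | bhat in @Omega_o n s c1].

(* a may be +oo at finitely many n, where Omega_o is empty. *)
Definition asymp_equiv (a : nat -> \bar R) (b : nat -> R) : Prop :=
  (0 < limn_einf (fun n => a n * (b n)^-1%:E) /\
   limn_esup (fun n => a n * (b n)^-1%:E) < +oo)%E.

End normal_means.

Arguments sparse_ball {R} n s _.
Arguments Omega_o {R} n s c1 _.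

(* Main.v *)
Require Import Defs.
From mathcomp Require Import all_boot all_order all_algebra.
From mathcomp Require Import all_classical all_reals all_analysis.
From mathcomp Require Import measurable_realfun.
From mathcomp Require Import ring lra.
Import Order.TTheory GRing.Theory Num.Theory.
Import numFieldNormedType.Exports.
Local Open Scope classical_set_scope.
Local Open Scope ring_scope.

(* Write [L = ln (n / s)].

   Lower bound.  Put spikes of height [mu], [mu ^+ 2 = (c1 + e) * L], on a set
   [S] of [s] coordinates.  A missed spike costs [mu ^+ 2], so a rate optimal
   estimator detects on average a fraction at least [e / (c1 + e)] of them.
   Removing the spike at [j] tilts the law of [y_j]; off a tail event the
   likelihood ratio is at most [expR (mu ^+ 2 / 2 + K * mu)], so a true
   detection at [j] under [S] becomes a false one under [S :\ j].  Averaging over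
   all [S], each set of size [s - 1] receives its [n - s + 1] possible false
   positives, which gives [(n - s + 1) * expR (- (c1 + e) * L / 2 - O(sqrt L))].

   Upper bound.  In the sparse regime, soft thresholding at
   [t ^+ 2 = c1 * L - 20] has risk at most [c1 * s * L] even for [c1 = 2], because
   its risk at zero carries an extra factor [t ^- 2]; its false positives number
   at most [2 * n * expR (- t ^+ 2 / 2)].  In the dense regime [n] is a trivial
   upper bound.  All Gaussian estimates reduce to the fact that exponential tilts
   of unit Gaussians are unit Gaussians. *)

(** * Unit Gaussians on the line: densities and exponential tilts *)

Lemma ge0_integral_normal_prob {R : realType} (m s : R) (f : R -> \bar R) :
  measurable_fun [set: R] f -> (forall x, 0 <= f x)%E ->
  (\int[normal_prob m s]_x f x =
   \int[lebesgue_measure]_x (f x * (normal_pdf m s x)%:E))%E.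
Proof.
move=> mf f0.
have dom := normal_prob_dominates m s.
rewrite -(Radon_Nikodym_SigmaFinite.change_of_variables dom)//.
have mg := measurable_int _ (Radon_Nikodym_SigmaFinite.f_integrable dom).
have mpdf := measurable_int _ (integrable_normal_pdf m s).
apply: ae_eq_integral => //.
- exact: emeasurable_funM.
- exact: emeasurable_funM.
apply: ae_eqe_mul2l.
(* The Radon-Nikodym derivative and the explicit density have the same integral over every
   measurable set, hence agree almost everywhere. *)
apply: integral_ae_eq => //.
  exact: (Radon_Nikodym_SigmaFinite.f_integrable dom).
move=> E _ mE.
by rewrite -Radon_Nikodym_SigmaFinite.f_integral.
Qed.

Lemma normal_pdf_tilt {R : realType} (m d x : R) :
  normal_pdf (m + d) 1 x =
  normal_pdf m 1 x * expR (d * (x - m) - d ^+ 2 / 2).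
Proof.
rewrite !normal_pdfE ?oner_neq0// -mulrA /normal_fun -expRD; congr (_ * expR _).
by field.
Qed.

(** A pair in [L] is a weight followed by a shift of the mean. Weights may be negative, so
    integrability has to be carried through the induction. *)
Lemma integral_normal_pdf_lincomb {R : realType} (m : R) (L : seq (R * R)) :
  let g := fun x => (\sum_(p <- L) p.1 * normal_pdf (m + p.2) 1 x)%:E in
  lebesgue_measure.-integrable [set: R] g /\
  (\int[lebesgue_measure]_x g x = (\sum_(p <- L) p.1)%:E)%E.
Proof.
elim: L => [|p L [IHi IHe]] /=.
  under eq_fun do rewrite big_nil.
  by rewrite big_nil integral0; split => //; exact: integrable0.
have ip : lebesgue_measure.-integrable [set: R]
    (fun x => (p.1%:E * (normal_pdf (m + p.2) 1 x)%:E)%E).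
  exact: (integrableZl measurableT p.1 (integrable_normal_pdf (m + p.2) 1)).
under eq_fun do rewrite big_cons EFinD EFinM.
rewrite big_cons; split; first exact: integrableD.
rewrite integralD// IHe integralZl//; last exact: integrable_normal_pdf.
by rewrite integral_normal_pdf mule1.
Qed.

(* Exponential tilts of N(m, 1) are again unit Gaussians, so a bound of the
   integrand by a combination of tilts integrates for free. *)
Lemma integral_normal_prob_le_tilts {R : realType} (m : R) (f : R -> R)
    (L : seq (R * R)) :
  measurable_fun [set: R] f -> (forall x, 0 <= f x) ->
  (forall x, f x <=
    \sum_(p <- L) p.1 * expR (p.2 * (x - m) - p.2 ^+ 2 / 2)) ->
  (\int[normal_prob m 1]_x (f x)%:E <= (\sum_(p <- L) p.1)%:E)%E.
Proof.
move=> mf f0 fL; have [ig <-] := integral_normal_pdf_lincomb m L.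
rewrite ge0_integral_normal_prob//; last exact/measurable_EFinP.
have fg x : f x * normal_pdf m 1 x <=
    \sum_(p <- L) p.1 * normal_pdf (m + p.2) 1 x.
  under eq_bigr do rewrite normal_pdf_tilt mulrCA mulrC.
  by rewrite -mulr_suml ler_wpM2r ?normal_pdf_ge0.
apply: ge0_le_integral => //.
- by move=> x _; rewrite mule_ge0 ?lee_fin// normal_pdf_ge0.
- apply: emeasurable_funM; first exact/measurable_EFinP.
  exact: (measurable_int _ (integrable_normal_pdf m 1)).
- exact: measurable_int ig.
- by move=> x _; rewrite -EFinM lee_fin.
Qed.

(** The likelihood ratio [expR (d * (x - m) - d ^+ 2 / 2)] increases with [x] as [0 <= d]; at the
    truncation point [x = m + d + K] it equals the constant on the right. *)
Lemma normal_prob_tilt_le {R : realType} (m d K : R) (h : R -> \bar R) :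
  0 <= d -> measurable_fun [set: R] h -> (forall x, 0 <= h x)%E ->
  (\int[normal_prob (m + d) 1]_x
      (h x * (\1_[set y | y <= m + d + K]%R x)%:E) <=
   (expR (d ^+ 2 / 2 + K * d))%:E * \int[normal_prob m 1]_x h x)%E.
Proof.
move=> d0 mh h0.
have mI : measurable_fun [set: R] (fun x => (\1_[set y | y <= m + d + K] x : R)%:E).
  apply/measurable_EFinP/measurable_indic.
  by rewrite -set_itvNyc; exact: measurable_itv.
have I0 (x : R) : (0 <= (\1_[set y | y <= m + d + K] x : R)%:E)%E.
  by rewrite lee_fin indicE.
have mhI : measurable_fun [set: R]
    (fun x => h x * (\1_[set y | y <= m + d + K]%R x)%:E)%E.
  exact: emeasurable_funM.
have mp a : measurable_fun [set: R] (fun x => (normal_pdf a 1 x : R)%:E).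
  exact: (measurable_int _ (integrable_normal_pdf a 1)).
have p0 a x : (0 <= (normal_pdf a 1 x : R)%:E)%E.
  by rewrite lee_fin normal_pdf_ge0.
rewrite !ge0_integral_normal_prob//; last by move=> x; rewrite mule_ge0.
rewrite -ge0_integralZl//; first last.
- by move=> x _; rewrite mule_ge0.
- by apply: emeasurable_funM; [exact: mh|exact: mp].
apply: ge0_le_integral => //.
- by move=> x _; rewrite !mule_ge0.
- by apply: emeasurable_funM; [exact: mhI|exact: mp].
- apply: measurable_funeM.
  by apply: emeasurable_funM; [exact: mh|exact: mp].
move=> x _; rewrite -muleA [leRHS]muleCA; apply: lee_wpmul2l => //.
rewrite -!EFinM lee_fin indicE; have [|_] := boolP (x \in _).
  rewrite inE/= => xK; rewrite mul1r normal_pdf_tilt mulrC.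
  rewrite ler_wpM2r ?normal_pdf_ge0// ler_expR.
  have : d * (x - m) <= d * (d + K) by rewrite ler_wpM2l//; lra.
  by move=> ?; lra.
by rewrite mul0r mulr_ge0 ?expR_ge0 ?normal_pdf_ge0.
Qed.

(** * The product Gaussian: change of measure in one coordinate, marginals *)

Lemma tnth_behead_lift (T : Type) n (t : n.+1.-tuple T) (i : 'I_n) :
  tnth [tuple of behead t] i = tnth t (lift ord0 i).
Proof. by rewrite [in RHS](tuple_eta t) tnthS. Qed.

(** Induction on the dimension through sections of [A] along the first coordinate. If [j] is a later
    coordinate, the bound for the tails is integrated; if [j] is the first, the one-dimensional tilt
    is applied to the measure of the section. *)
Lemma gaussian_tilt_le {R : realType} n (b b' : n.-tuple R) (j : 'I_n) (d K : R)
    (A : set (n.-tuple R)) :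
  0 <= d -> tnth b' j = tnth b j + d ->
  (forall i, i != j -> tnth b' i = tnth b i) -> measurable A ->
  (gaussian b' (A `&` [set y | (tnth y j <= tnth b' j + K)%R]) <=
   (expR (d ^+ 2 / 2 + K * d))%:E * gaussian b A)%E.
Proof.
move=> d0; elim: n b b' j A => [|n IH] b b' j A; first by case: j.
move=> bj bi mA.
have mB (i : 'I_n.+1) (x : R) : measurable [set y : n.+1.-tuple R | tnth y i <= x].
  rewrite (_ : [set _ | _] = (@tnth n.+1 R ^~ i) @^-1` `]-oo, x]).
    by rewrite -[X in measurable X]setTI; apply: measurable_tnth => //;
       exact: measurable_itv.
  by apply/seteqP; split => y /=; rewrite in_itv.
have mC (S : set (n.+1.-tuple R)) : measurable S -> measurable (@consp R n @^-1` S).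
  by move=> mS; rewrite -[X in measurable X]setTI; exact: measurable_consp.
have mX (c : n.-tuple R) (S : set (n.+1.-tuple R)) : measurable S ->
    measurable_fun [set: measurableTypeR R]
      (fun x => gaussian c (xsection (@consp R n @^-1` S) x)).
  by move=> mS; exact: (measurable_fun_xsection (gaussian c) (mC _ mS)).
rewrite /= /distribution /pushforward /product_measure1 /=.
case: (unliftP ord0 j) => [i jE|jE].
- have <- : thead b' = thead b by apply: bi; rewrite jE.
  rewrite -ge0_integralZl//; last exact: mX.
  apply: ge0_le_integral => //.
  + by apply: mX; apply: measurableI => //; exact: mB.
  + by apply: measurable_funeM; exact: mX.
  + move=> x _.
    have -> : xsection (@consp R n @^-1`
        (A `&` [set y | (tnth y j <= tnth b' j + K)%R])) x =
        xsection (@consp R n @^-1` A) x `&`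
        [set y | (tnth y i <= tnth [tuple of behead b'] i + K)%R].
      by rewrite !xsectionE; apply/seteqP; split => y /=;
        rewrite tnth_behead_lift jE /consp /= tnthS.
    apply: IH => //.
    * by rewrite !tnth_behead_lift -jE.
    * by move=> k ki; rewrite !tnth_behead_lift; apply: bi; rewrite jE (inj_eq lift_inj).
    * by apply: measurable_xsection; exact: mC.
- subst j.
  have -> : [tuple of behead b'] = [tuple of behead b].
    apply: eq_from_tnth => i; rewrite !tnth_behead_lift.
    exact: bi.
  have -> : thead b' = thead b + d by [].
  rewrite bj.
  apply: (le_trans _ (normal_prob_tilt_le _ d K _ d0 (mX _ _ mA) _)) => //.
  apply: ge0_le_integral => //.
  + by apply: mX; apply: measurableI => //; exact: mB.
  + apply: emeasurable_funM; first exact: mX.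
    apply/measurable_EFinP/measurable_indic.
    by rewrite -set_itvNyc; exact: measurable_itv.
  (* The truncation now constrains [x] itself: beyond it the section is empty, below it the
     truncation may be dropped. *)
  move=> x _; rewrite indicE; have [|] := boolP (x \in _); last first.
    rewrite notin_setE/= => /negP xK.
    rewrite mule0 (_ : xsection _ _ = set0) ?measure0//.
    by rewrite xsectionE; apply/seteqP; split => y //= [_]; rewrite (negbTE xK).
  move=> _; rewrite mule1 le_measure ?inE//.
  + by apply: measurable_xsection; apply: mC; apply: measurableI => //; exact: mB.
  + by apply: measurable_xsection; exact: mC.
  + by rewrite !xsectionE => y [].
Qed.

Lemma integral_gaussian_tnth {R : realType} n (b : n.-tuple R) (i : 'I_n)
    (f : R -> \bar R) :
  measurable_fun [set: R] f -> (forall x, 0 <= f x)%E ->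
  (\int[gaussian b]_y f (tnth y i) =
   \int[normal_prob (tnth b i) 1]_x f x)%E.
Proof.
move=> mf f0.
have mt : measurable_fun [set: n.-tuple R]
    (fun y : n.-tuple R => tnth y i : measurableTypeR R).
  exact: measurable_tnth.
rewrite -(preimage_setT (@tnth n R ^~ i)).
rewrite -(@ge0_integral_pushforward _ _ _ _ _ _ mt (gaussian b) setT f)//.
apply: eq_measure_integral => A mA _ /=; rewrite /pushforward.
(* A cylinder is a box with full sides off [i], so its measure is the marginal one. *)
have -> : (@tnth n R ^~ i) @^-1` A =
    [set y | forall k, (if k == i then A else setT) (tnth y k)].
  apply/seteqP; split => y /= => [Ay k|/(_ i)]; last by rewrite eqxx.
  by case: eqP => // ->.
rewrite (gaussian_box b (A := fun k => if k == i then A else setT)); last first.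
  by move=> k; case: ifP.
rewrite (bigD1 i)//= eqxx big1 ?mule1// => k ki.
by rewrite (negbTE ki) probability_setT.
Qed.

Lemma expectation_gaussian_sum {R : realType} n (b : n.-tuple R)
    (f : 'I_n -> R -> R) :
  (forall i, measurable_fun [set: R] (f i)) -> (forall i x, 0 <= f i x) ->
  ('E_(gaussian b)[fun y => (\sum_i f i (tnth y i))%R] =
   \sum_i \int[normal_prob (tnth b i) 1]_x (f i x)%:E)%E.
Proof.
move=> mf f0; rewrite unlock.
under eq_integral do rewrite -sumEFin.
rewrite ge0_integral_sum//.
- apply: eq_bigr => i _.
  by rewrite (integral_gaussian_tnth _ b i (fun x => (f i x)%:E))//;
    [exact/measurable_EFinP|move=> x; rewrite lee_fin].
- move=> i; apply/measurable_EFinP.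
  by apply: (measurableT_comp (mf i)); exact: measurable_tnth.
- by move=> i y _; rewrite lee_fin.
Qed.

(** * Soft thresholding of a single Gaussian observation *)

Section soft_threshold.
Context {R : realType}.
Implicit Types t x m : R.

Definition clip t x : R := Num.max (- t) (Num.min t x).

(** Written as the residual of the projection onto [[- t, t]], so that the estimation error is the
    noise minus [clip t x]. *)
Definition soft t x : R := x - clip t x.

Lemma measurable_soft t : measurable_fun [set: R] (soft t).
Proof.
apply: measurable_funB => //; apply: measurable_maxr => //.
exact: measurable_minr.
Qed.

Lemma softE t x : 0 <= t ->
  soft t x = if t < x then x - t else if x < - t then x + t else 0.
Proof.
move=> t0; rewrite /soft /clip.
have [tx|xt] := boolP (t < x).
  by rewrite min_l ?ltW// max_r//; lra.
rewrite -leNgt in xt; rewrite min_r//.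
have [xt'|xt'] := boolP (x < - t).
  by rewrite max_l ?ltW// opprK.
by rewrite -leNgt in xt'; rewrite max_r// subrr.
Qed.

Lemma clip_bound t x : 0 <= t -> - t <= clip t x <= t.
Proof.
move=> t0; rewrite /clip le_max lexx/= ge_max; apply/andP; split; first lra.
by rewrite ge_min lexx.
Qed.

Lemma clip_mono t : {homo clip t : x y / x <= y}.
Proof.
move=> x y xy; rewrite /clip ge_max !le_max lexx/=; apply/orP; right.
by rewrite le_min !ge_min lexx xy orbT.
Qed.

Lemma sqr_le_expR x : 0 <= x -> x ^+ 2 <= 4 * expR x.
Proof.
move=> x0; have -> : expR x = expR (x / 2) ^+ 2 by rewrite -expRM_natl; congr expR; lra.
have := expR_ge1Dx (x / 2) => h.
have : (x / 2) ^+ 2 <= expR (x / 2) ^+ 2 by rewrite lerXn2r ?nnegrE ?expR_ge0//; lra.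
by rewrite expr_div_n; lra.
Qed.

Lemma sqr_le_expR_sym x : x ^+ 2 <= 4 * expR x + 4 * expR (- x).
Proof.
have [x0|x0] := leP 0 x.
  by rewrite (le_trans (sqr_le_expR _ x0))// lerDl mulr_ge0 ?expR_ge0.
rewrite -sqrrN (le_trans (sqr_le_expR (- x) _))//; first lra.
by rewrite lerDr mulr_ge0 ?expR_ge0.
Qed.

(** From [1 - x <= expR (- x)], the exponential is at most the inverse of [1 - x], which is below
    [1 + 2 * x] on this interval. *)
Lemma expR_le_1D2x x : 0 <= x <= 1 / 2 -> expR x <= 1 + 2 * x.
Proof.
move=> /andP[x0 x1]; have h := expR_ge1Dx (- x).
have e : expR x * expR (- x) = 1 by rewrite -expRD subrr expR0.
have := expR_gt0 x; nra.
Qed.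

(* The bound [t^2 + O(1)] uses that [clip] is monotone, so that it correlates
   nonnegatively with the noise, and [2 c z <= 2 t^2 (expR (c z / t^2) - 1)]
   in place of the vanishing first moment. *)
Lemma soft_risk_le m t : 1 <= t ->
  (\int[normal_prob m 1]_x ((m - soft t x) ^+ 2)%:E <= (t ^+ 2 + 18)%:E)%E.
Proof.
move=> t1; have t0 : 0 < t by lra.
set c := - clip t m; set a := c / t ^+ 2.
have c2 : c ^+ 2 <= t ^+ 2.
  have /andP[] := @clip_bound t m (ltW t0); rewrite /c; nra.
(* These weights encode the pointwise bound [- t ^+ 2 + 2 * t ^+ 2 * expR (a * z) + 4 * expR z + 4 *
   expR (- z)], where [z = x - m]; the factors [expR (d ^+ 2 / 2)] normalise the tilts. *)
pose L : seq (R * R) := [:: (- t ^+ 2, 0); (2 * t ^+ 2 * expR (a ^+ 2 / 2), a);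
  (4 * expR (1 / 2), 1); (4 * expR (1 / 2), -1)].
apply: (@le_trans _ _ (\sum_(p <- L) p.1)%:E).
  apply: integral_normal_prob_le_tilts.
  - apply: measurable_funX; apply: measurable_funB => //; exact: measurable_soft.
  - by move=> x; exact: sqr_ge0.
  move=> x; rewrite /L !big_cons big_nil/=.
  set z := x - m.
  have tilt d : expR (d ^+ 2 / 2) * expR (d * z - d ^+ 2 / 2) = expR (d * z).
    by rewrite -expRD addrC subrK.
  have := tilt 1; have := tilt (-1); rewrite sqrrN expr1n mulN1r mul1r => tiltN1 tilt1.
  rewrite -[X in _ + (X + _)]mulrA tilt -![4 * _ * _]mulrA.
  rewrite tilt1 tiltN1 mul1r.
  rewrite (_ : 0 * z - _ = 0) ?expR0 ?mulr1 ?addr0; last by field.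
  have h1 := sqr_le_expR_sym z.
  have h2 := expR_ge1Dx (a * z).
  have t2 : 0 < t ^+ 2 by rewrite exprn_gt0.
  have az : t ^+ 2 * (a * z) = c * z by rewrite /a; field; lra.
  have h3 : c * z <= t ^+ 2 * (expR (a * z) - 1) by rewrite -az ler_pM2l//; lra.
  have h4 : z * (clip t x + c) >= 0.
    rewrite /c /z; have [xm|xm] := leP m x.
      by apply: mulr_ge0; rewrite subr_ge0//; exact: clip_mono.
    by apply: mulr_le0; rewrite subr_le0 ?clip_mono// ltW.
  have h5 : clip t x ^+ 2 <= t ^+ 2.
    have /andP[] := @clip_bound t x (ltW t0); nra.
  have -> : m - soft t x = - (z - clip t x) by rewrite /soft /z; ring.
  nra.
rewrite lee_fin /L !big_cons big_nil/=.
have h1 : expR (1 / 2) <= 2 :> R.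
  by rewrite (le_trans (expR_le_1D2x _ _))//; lra.
have t2 : 1 <= t ^+ 2 by nra.
(* As [a ^+ 2 <= t ^- 2], the second weight exceeds [2 * t ^+ 2] by at most 2; the last two weights
   add at most 16, whence 18. *)
have a2 : a ^+ 2 / 2 <= t ^- 2 / 2.
  rewrite ler_pM2r// /a expr_div_n -exprM.
  rewrite ler_pdivrMr ?exprn_gt0// (_ : t ^- 2 * _ = t ^+ 2)//.
  by field; lra.
have ti : t ^- 2 <= 1 by rewrite invf_le1//; lra.
have h2 : expR (a ^+ 2 / 2) <= 1 + t ^- 2.
  rewrite (le_trans (expR_le_1D2x _ _))//; last lra.
  by apply/andP; split; [rewrite divr_ge0 ?sqr_ge0|lra].
have h3 : t ^+ 2 * expR (a ^+ 2 / 2) <= t ^+ 2 + 1.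
  rewrite (le_trans (ler_wpM2l _ h2)) ?sqr_ge0// mulrDr mulr1 mulfV//.
  by rewrite expf_neq0//; lra.
lra.
Qed.

(** An overshoot [w] past the threshold satisfies [(t * w) ^+ 2 <= 4 * expR (t * w)], the source of
    [t ^- 2]; completing the exponent turns the right side into a tilt by [t] or [- t]. *)
Lemma soft_risk0_le t : 0 < t ->
  (\int[normal_prob 0 1]_x ((0 - soft t x) ^+ 2)%:E <=
   (8 * expR (- (t ^+ 2 / 2)) / t ^+ 2)%:E)%E.
Proof.
move=> t0.
set a := 4 * expR (- (t ^+ 2 / 2)) / t ^+ 2.
have a0 : 0 <= a by rewrite !mulr_ge0 ?invr_ge0 ?expR_ge0 ?sqr_ge0.
pose L : seq (R * R) := [:: (a, t); (a, - t)].
apply: (@le_trans _ _ (\sum_(p <- L) p.1)%:E); last first.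
  by rewrite lee_fin /L !big_cons big_nil/= /a addr0 -mulrDl -mulrDl; lra.
have key w : 0 <= w -> w ^+ 2 <= a * expR (t * w + t ^+ 2 / 2).
  move=> w0; rewrite /a mulrAC -[4 * _ * _]mulrA -expRD addrC addrK.
  by rewrite ler_pdivlMr ?exprn_gt0// -exprMn mulrC sqr_le_expR// mulr_ge0// ltW.
apply: integral_normal_prob_le_tilts.
- apply: measurable_funX; apply: measurable_funB => //; exact: measurable_soft.
- by move=> x; exact: sqr_ge0.
move=> x; rewrite /L !big_cons big_nil/= addr0 subr0 sub0r sqrrN softE; last exact: ltW.
case: ltP => [tx|xt].
  rewrite (le_trans (key (x - t) _))//; first lra.
  rewrite (_ : t * (x - t) + _ = t * x - t ^+ 2 / 2); last by field.
  by rewrite lerDl mulr_ge0 ?expR_ge0.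
case: ltP => [xt'|xt'].
  rewrite -sqrrN (le_trans (key _ _))//; first lra.
  rewrite (_ : t * _ + _ = - t * x - (- t) ^+ 2 / 2); last by field.
  by rewrite lerDr mulr_ge0 ?expR_ge0.
by rewrite expr0n/= addr_ge0// mulr_ge0 ?expR_ge0.
Qed.

Lemma measurable_soft_neq0 t :
  measurable_fun [set: R] (fun x => (soft t x != 0)%:R : R).
Proof.
rewrite (_ : (fun _ => _) = \1_(soft t @^-1` [set~ 0])).
  apply: measurable_indic; rewrite -[X in measurable X]setTI.
  by apply: measurable_soft => //; exact: measurableC.
apply/funext => x; rewrite indicE; congr (_%:R); congr nat_of_bool.
by apply/idP/idP; rewrite inE/= => /eqP.
Qed.

(** Chernoff bound: beyond [t] in absolute value, one of the two tilts by [t] and [- t], weighted by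
    [a], is at least 1. *)
Lemma soft_neq0_le t : 0 < t ->
  (\int[normal_prob 0 1]_x ((soft t x != 0)%:R)%:E <=
   (2 * expR (- (t ^+ 2 / 2)))%:E)%E.
Proof.
move=> t0; set a := expR (- (t ^+ 2 / 2)).
pose L : seq (R * R) := [:: (a, t); (a, - t)].
apply: (@le_trans _ _ (\sum_(p <- L) p.1)%:E); last first.
  by rewrite lee_fin /L !big_cons big_nil/=; lra.
apply: integral_normal_prob_le_tilts; first exact: measurable_soft_neq0.
  by move=> x; exact: ler0n.
move=> x; rewrite /L !big_cons big_nil/= addr0 subr0 softE; last exact: ltW.
rewrite /a -!expRD.
case: ltP => [tx|xt].
  apply: (@le_trans _ _ 1); first by rewrite lern1 leq_b1.
  apply: ler_wpDr; first exact: expR_ge0.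
  by rewrite -[leLHS]expR0 ler_expR; nra.
case: ltP => [xt'|xt'].
  apply: (@le_trans _ _ 1); first by rewrite lern1 leq_b1.
  apply: ler_wpDl; first exact: expR_ge0.
  by rewrite -[leLHS]expR0 ler_expR; nra.
by rewrite eqxx addr_ge0 ?expR_ge0.
Qed.

End soft_threshold.

(** * Soft thresholding in dimension [n]: the upper bound *)

Lemma natr_card {R : realType} (T : finType) (P : pred T) :
  (#|P|%:R : R) = \sum_i (P i)%:R.
Proof.
rewrite -sum1_card natr_sum big_mkcond; apply: eq_bigr => i _.
by rewrite -topredE/=; case: (P i).
Qed.

Section upper_bound.
Context {R : realType}.

Definition soft_est n (t : R) (y : n.-tuple R) : n.-tuple R :=
  [tuple soft t (tnth y i) | i < n].

Lemma measurable_soft_est n (t : R) :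
  measurable_fun [set: n.-tuple R] (@soft_est n t).
Proof.
apply/measurable_fun_tnthP => i.
rewrite (_ : _ \o _ = soft t \o (@tnth n R ^~ i)); last first.
  by apply/funext => y /=; rewrite tnth_mktuple.
by apply: measurableT_comp; [exact: measurable_soft|exact: measurable_tnth].
Qed.

Lemma max_risk_soft_est n (s : nat) (t : R) : 1 <= t ->
  (max_risk s (@soft_est n t) <=
   (s%:R * (t ^+ 2 + 18) +
    n%:R * (8 * expR (- (t ^+ 2 / 2)) / t ^+ 2))%:E)%E.
Proof.
move=> t1; have t0 : 0 < t by lra.
set r1 := t ^+ 2 + 18; set r0 := 8 * _ / _.
have r1_ge0 : 0 <= r1 by rewrite addr_ge0 ?sqr_ge0.
have r0_ge0 : 0 <= r0 by rewrite !mulr_ge0 ?invr_ge0 ?expR_ge0 ?sqr_ge0.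
apply: ge_ereal_sup => _ [b bs <-].
rewrite (_ : (fun y => _) = (fun y => \sum_i
    (tnth b i - soft t (tnth y i)) ^+ 2)); last first.
  by apply/funext => y; apply: eq_bigr => i _; rewrite tnth_mktuple.
rewrite (expectation_gaussian_sum _ b (fun i x => (tnth b i - soft t x) ^+ 2)).
(* Every coordinate is charged [r0], and the at most [s] nonzero ones [r1] in addition. *)
- apply: (@le_trans _ _ (\sum_(i < n) ((tnth b i != 0)%:R * r1 + r0)%:E)%E).
    apply: lee_sum => i _; have [->|bi0] := eqVneq (tnth b i) 0.
      by rewrite mul0r add0r; exact: soft_risk0_le.
    rewrite mul1r (le_trans (soft_risk_le _ _ t1))// lee_fin lerDl//.
  rewrite sumEFin lee_fin big_split/= -mulr_suml sumr_const card_ord -[r0 *+ n]mulr_natl.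
  by rewrite lerD2r ler_wpM2r// -(natr_card _ [pred i | tnth b i != 0]) ler_nat.
- move=> i; apply: measurable_funX; apply: measurable_funB => //.
  exact: measurable_soft.
- by move=> i x; exact: sqr_ge0.
Qed.

Lemma max_FP_soft_est n (s : nat) (t : R) : 0 < t ->
  (max_FP s (@soft_est n t) <= (n%:R * (2 * expR (- (t ^+ 2 / 2))))%:E)%E.
Proof.
move=> t0; set r0 := 2 * _.
have r0_ge0 : 0 <= r0 by rewrite mulr_ge0 ?expR_ge0.
apply: ge_ereal_sup => _ [b bs <-].
rewrite (_ : (fun y => _) = (fun y => \sum_i
    (tnth b i == 0)%:R * (soft t (tnth y i) != 0)%:R)); last first.
  apply/funext => y; rewrite /FP natr_card; apply: eq_bigr => i _.
  by rewrite /= tnth_mktuple andbC -natrM mulnb.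
rewrite (expectation_gaussian_sum _ b
  (fun i x => (tnth b i == 0)%:R * (soft t x != 0)%:R)).
- apply: (@le_trans _ _ (\sum_(i < n) r0%:E)%E).
    apply: lee_sum => i _; have [->|bi0] := eqVneq (tnth b i) 0.
      under eq_integral do rewrite mul1r.
      exact: soft_neq0_le.
    by under eq_integral do rewrite mul0r; rewrite integral0 lee_fin.
  by rewrite sumEFin lee_fin sumr_const card_ord -[r0 *+ n]mulr_natl.
- by move=> i; apply: measurable_funM => //; exact: measurable_soft_neq0.
- by move=> i x; rewrite mulr_ge0 ?ler0n.
Qed.

(* The threshold [t^2 = c1 ln (n/s) - 20] leaves room for the additive
   constants of the risk, at the price of a factor [expR 10] in the false
   positives. *)
Lemma minimax_FP_le n (s : nat) (c1 : R) : (0 < s <= n)%N -> 2 <= c1 ->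
  4 * expR 10 + 20 <= c1 * ln (n%:R / s%:R) ->
  (minimax_FP n s c1 <=
   (2 * expR 10 * (n%:R * (s%:R / n%:R) `^ (c1 / 2)))%:E)%E.
Proof.
move=> /andP[s0 sn] c2; set L := ln _ => hL.
have n0 : (0 < n)%N by exact: leq_trans s0 sn.
have sR : 0 < s%:R :> R by rewrite ltr0n.
have nR : 0 < n%:R :> R by rewrite ltr0n.
have pE : (s%:R / n%:R) `^ (c1 / 2) = expR (- (c1 * L / 2)) :> R.
  rewrite /powR ifF; last by apply/negP; rewrite gt_eqF// divr_gt0.
  congr expR; rewrite /L -[n%:R / s%:R]invf_div lnV ?posrE ?divr_gt0//; lra.
have L0 : 0 <= L by rewrite ln_ge0// ler_pdivlMr// mul1r ler_nat.
have e1 : 1 <= expR 10 :> R by rewrite (le_trans _ (expR_ge1Dx _))//; lra.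
set t := Num.sqrt (c1 * L - 20).
have t2 : t ^+ 2 = c1 * L - 20 by rewrite sqr_sqrtr//; lra.
have t20 : 4 * expR 10 <= t ^+ 2 by rewrite t2; lra.
have t_ge0 : 0 <= t by exact: sqrtr_ge0.
have t1 : 1 <= t by rewrite -(@ler_pXn2r _ 2) ?nnegrE//; lra.
have te : expR (- (t ^+ 2 / 2)) = expR 10 * expR (- (c1 * L / 2)).
  by rewrite t2 -expRD; congr expR; lra.
(* Here [2 <= c1] enters: [(s / n) ^ (c1 / 2)] is at most [s / n]. *)
have nle : n%:R * expR (- (c1 * L / 2)) <= s%:R :> R.
  rewrite -ler_pdivlMl// [leRHS]mulrC -[leRHS]lnK ?posrE ?divr_gt0// ler_expR.
  by rewrite -[s%:R / n%:R]invf_div lnV ?posrE ?divr_gt0// -/L; nra.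
apply: (@le_trans _ _ (max_FP s (@soft_est n t))); last first.
  rewrite (le_trans (max_FP_soft_est _ _ _ _))//; first lra.
  by rewrite lee_fin te pE; lra.
apply: ereal_inf_lbound; exists (@soft_est n t) => //; split.
  exact: measurable_soft_est.
rewrite (le_trans (max_risk_soft_est _ _ _ t1))// lee_fin te.
(* Since [4 * expR 10 <= t ^+ 2], the zero coordinates cost at most [2 * s]. With the 18 of each
   nonzero coordinate this uses up exactly the 20 subtracted in [t ^+ 2]. *)
have h : n%:R * (8 * (expR 10 * expR (- (c1 * L / 2))) / t ^+ 2) <= s%:R * 2.
  rewrite !mulrA ler_pdivrMr; last by lra.
  nra.
by rewrite -/L; nra.
Qed.

End upper_bound.

(** * Double counting over supports *)

Lemma sum_setD1 {R : realType} (T : finType) m (q : {set T} -> T -> R) :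
  \sum_(S : {set T} | #|S| == m.+1) \sum_(j in S) q (S :\ j)%SET j =
  \sum_(S : {set T} | #|S| == m) \sum_(j | j \notin S) q S j.
Proof.
rewrite (exchange_big_dep xpredT)//= [RHS](exchange_big_dep xpredT)//=.
apply: eq_bigr => j _.
(* For fixed [j], deleting [j] is a bijection from the sets containing [j] to those avoiding it,
   with inverse [j |: S]. *)
rewrite (reindex_onto (fun S : {set T} => (j |: S)%SET) (fun S => (S :\ j)%SET))/=;
  last by move=> S /andP[_ jS]; rewrite finset.setD1K.
apply: eq_big => [S|S /andP[_ /eqP->]//].
rewrite setU11 andbT; have [jS|jS] := boolP (j \in S).
  rewrite andbF; apply/negP => /andP[_ /eqP SE].
  by move: jS; rewrite -SE !inE eqxx.
by rewrite cardsU1 jS add1n eqSS setU1K// eqxx !andbT.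
Qed.

(** Summing the hypothesis over all sets of size [m.+1] and moving to sets of size [m], some set
    reaches the average; [m.+1 * 'C(n, m.+1) = (n - m) * 'C(n, m)] matches the two
    normalisations. *)
Lemma exists_sum_setC_ge {R : realType} n m (q : {set 'I_n} -> 'I_n -> R) (k : R) :
  (m < n)%N ->
  (forall S : {set 'I_n}, #|S| = m.+1 ->
    m.+1%:R * k <= \sum_(j in S) q (S :\ j)%SET j) ->
  exists2 S : {set 'I_n}, #|S| = m &
    (n - m)%:R * k <= \sum_(j | j \notin S) q S j.
Proof.
move=> mn hq; apply: contrapT => hS.
have cd d : #|[set S : {set 'I_n} | #|S| == d]%SET| = 'C(n, d).
  by rewrite card_draws card_ord.
have lt_q (S : {set 'I_n}) : #|S| == m -> \sum_(j | j \notin S) q S j < (n - m)%:R * k.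
  by move=> /eqP Sm; rewrite ltNge; apply/negP => h; apply: hS; exists S.
have h1 : 'C(n, m.+1)%:R * (m.+1%:R * k) <=
    \sum_(S : {set 'I_n} | #|S| == m.+1) \sum_(j in S) q (S :\ j)%SET j.
  rewrite [leLHS]mulr_natl -cd -sumr_const.
  by rewrite (eq_bigl (fun S : {set 'I_n} => #|S| == m.+1)) ?ler_sum// => S;
    rewrite ?inE// => /eqP; exact: hq.
have h2 : \sum_(S : {set 'I_n} | #|S| == m) \sum_(j | j \notin S) q S j <
    'C(n, m)%:R * ((n - m)%:R * k).
  rewrite [ltRHS]mulr_natl -cd -sumr_const.
  rewrite [ltRHS](eq_bigl (fun S : {set 'I_n} => #|S| == m)); last by move=> S; rewrite inE.
  have : (0 < #|[set S : {set 'I_n} | #|S| == m]%SET|)%N.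
    by rewrite cd bin_gt0 ltnW.
  move=> /card_gt0P[S0]; rewrite inE => S0m.
  rewrite (bigD1 S0)//= [ltRHS](bigD1 S0)//= ltr_leD ?lt_q//.
  by apply: ler_sum => S /andP[Sm _]; rewrite ltW// lt_q.
move: h2; rewrite -sum_setD1 => /(le_lt_trans h1).
by rewrite !mulrA -!natrM [X in X%:R * k](mulnC _ m.+1) mul_bin_left mulnC ltxx.
Qed.

(** * Spiked means and the lower bound at fixed [n] *)

Section lower_bound.
Context {R : realType}.

Definition spike {n} (mu : R) (S : {set 'I_n}) : n.-tuple R :=
  [tuple if i \in S then mu else 0 | i < n].

Lemma spike_sparse n (mu : R) (S : {set 'I_n}) (s : nat) :
  (#|S| <= s)%N -> sparse_ball n s (spike mu S).
Proof.
move=> Ss; apply: leq_trans Ss; apply: subset_leq_card.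
by apply/fintype.subsetP => i; rewrite !inE tnth_mktuple; case: ifP => //; rewrite eqxx.
Qed.

Lemma measurable_tnth_neq0 n (f : n.-tuple R -> n.-tuple R) (j : 'I_n) :
  measurable_fun [set: n.-tuple R] f ->
  measurable [set y | tnth (f y) j != 0].
Proof.
move=> /measurable_fun_tnthP/(_ j) mfj.
rewrite (_ : [set _ | _] = (@tnth n R ^~ j \o f) @^-1` [set~ 0]).
  by rewrite -[X in measurable X]setTI; apply: mfj => //; exact: measurableC.
by apply/seteqP; split => y /= /eqP.
Qed.

(** Chernoff bound with the single tilt by [K]. *)
Lemma gaussian_tail_le n (b : n.-tuple R) (j : 'I_n) (K : R) : 0 <= K ->
  (gaussian b [set y | tnth b j + K < tnth y j]%R <=
   (expR (- (K ^+ 2 / 2)))%:E)%E.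
Proof.
move=> K0; set a := expR _; set m := tnth b j.
have mI : measurable [set x : R | m + K < x].
  by rewrite -set_itvoy; exact: measurable_itv.
have mt : measurable [set y : n.-tuple R | m + K < tnth y j].
  rewrite (_ : [set _ | _] = (@tnth n R ^~ j) @^-1` [set x | m + K < x])//.
  by rewrite -[X in measurable X]setTI; exact: measurable_tnth.
rewrite -[X in gaussian b X]setIT -integral_indic//.
have -> : (\int[gaussian b]_y (\1_[set y : n.-tuple R | m + K < tnth y j]%R y)%:E =
    \int[gaussian b]_y (\1_[set x : R | m + K < x]%R (tnth y j))%:E)%E.
  by apply: eq_integral => y _; rewrite !indicE.
rewrite (integral_gaussian_tnth _ b j (fun x => (\1_[set x : R | m + K < x]%R x)%:E)).
- have -> : a = \sum_(p <- [:: (a, K)]) p.1 by rewrite big_seq1.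
  apply: integral_normal_prob_le_tilts.
  + exact: measurable_indic.
  + by move=> x; rewrite indicE ler0n.
  move=> x; rewrite big_seq1/= -expRD indicE.
  have [|_] := boolP (x \in _); last exact: expR_ge0.
  by rewrite inE/= -/m => mKx; rewrite -[leLHS]expR0 ler_expR; nra.
- exact/measurable_EFinP/measurable_indic.
- by move=> x; rewrite lee_fin indicE ler0n.
Qed.

Lemma integral_sum_indic d (T : measurableType d) (P : probability T R)
    (I : finType) (p : pred I) (c : R) (A : I -> set T) :
  0 <= c -> (forall i, measurable (A i)) ->
  (\int[P]_y (\sum_(i | p i) c * \1_(A i) y)%:E =
   \sum_(i | p i) c%:E * P (A i))%E.
Proof.
move=> c0 mA; under eq_integral do rewrite -sumEFin -big_filter.
rewrite ge0_integral_sum//.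
- rewrite big_filter; apply: eq_bigr => i _.
  under eq_integral do rewrite EFinM.
  rewrite ge0_integralZl//; last exact/measurable_EFinP/measurable_indic.
  by rewrite integral_indic// setIT.
- by move=> i; apply/measurable_EFinP/measurable_funM => //; exact: measurable_indic.
- by move=> i y _; rewrite lee_fin mulr_ge0// indicE ler0n.
Qed.

Lemma expectation_FP n (b : n.-tuple R) (f : n.-tuple R -> n.-tuple R) :
  measurable_fun [set: n.-tuple R] f ->
  ('E_(gaussian b)[fun y => (FP b (f y))%:R%R] =
   \sum_(j | tnth b j == 0%R) gaussian b [set y | tnth (f y) j != 0%R])%E.
Proof.
move=> mf; rewrite unlock.
under [RHS]eq_bigr do rewrite -[gaussian _ _]mul1e.
rewrite -integral_sum_indic//; last by move=> j; exact: measurable_tnth_neq0.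
apply: eq_integral => y _; rewrite /FP natr_card [in RHS]big_mkcond.
congr (_%:E); apply: eq_bigr => j _ /=; rewrite indicE mul1r andbC.
case: (tnth b j == 0) => //=; congr (_%:R); congr nat_of_bool.
by apply/idP/idP; rewrite inE.
Qed.

(** Only the loss at missed spikes is kept, where it is exactly [mu ^+ 2]. *)
Lemma expectation_sqdist_ge n (mu : R) (S : {set 'I_n})
    (f : n.-tuple R -> n.-tuple R) :
  measurable_fun [set: n.-tuple R] f ->
  (\sum_(j in S) (mu ^+ 2)%:E *
     gaussian (spike mu S) (~` [set y | (tnth (f y) j != 0)%R]) <=
   'E_(gaussian (spike mu S))[fun y => sqdist (spike mu S) (f y)])%E.
Proof.
move=> mf; have mf' := iffLR (measurable_fun_tnthP _) mf.
have mA j : measurable (~` [set y | tnth (f y) j != 0]).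
  by apply: measurableC; exact: measurable_tnth_neq0.
rewrite -integral_sum_indic ?sqr_ge0// expectation.unlock; apply: ge0_le_integral => //.
- by move=> y _; rewrite lee_fin sumr_ge0// => j _; rewrite mulr_ge0 ?sqr_ge0// indicE ler0n.
- apply/measurable_EFinP.
  under eq_fun do rewrite -big_filter.
  by apply: measurable_sum => j; apply: measurable_funM => //; exact: measurable_indic.
- apply/measurable_EFinP; apply: measurable_sum => j.
  by apply: measurable_funX; apply: measurable_funB => //; exact: mf'.
move=> y _; rewrite lee_fin big_mkcond/=; apply: ler_sum => j _.
case: ifPn => [jS|_]; last exact: sqr_ge0.
rewrite tnth_mktuple jS indicE; have [|_] := boolP (y \in _).
  by rewrite inE/= => /negP; rewrite negbK => /eqP ->; rewrite mulr1 subr0.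
by rewrite mulr0 sqr_ge0.
Qed.

(** [A] is split at [tnth y j <= mu + K]: below, the spike at [j] is removed by change of measure;
    above, the Gaussian tail bounds the probability. *)
Lemma spike_power_le n (mu K : R) (S : {set 'I_n}) (j : 'I_n)
    (A : set (n.-tuple R)) :
  0 <= mu -> 0 <= K -> j \in S -> measurable A ->
  (gaussian (spike mu S) A <=
   (expR (mu ^+ 2 / 2 + K * mu))%:E * gaussian (spike mu (S :\ j)%SET) A +
   (expR (- (K ^+ 2 / 2)))%:E)%E.
Proof.
move=> mu0 K0 jS mA; set b := spike mu S.
have bj : tnth b j = mu by rewrite tnth_mktuple jS.
pose B := [set y : n.-tuple R | tnth y j <= tnth b j + K].
have mB : measurable B.
  rewrite (_ : B = (@tnth n R ^~ j) @^-1` `]-oo, (tnth b j + K)]).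
    by rewrite -[X in measurable X]setTI; apply: measurable_tnth => //;
       exact: measurable_itv.
  by apply/seteqP; split => y; rewrite /B/= in_itv.
have BC : ~` B = [set y | tnth b j + K < tnth y j].
  by apply/seteqP; split => y; rewrite /B/= ltNge => /negP.
apply: (@le_trans _ _ (gaussian b (A `&` B) + gaussian b (~` B))%E).
  apply: (@le_trans _ _ (gaussian b ((A `&` B) `|` (~` B)))).
    apply: le_measure; rewrite ?inE//.
      by apply: measurableU; [exact: measurableI|exact: measurableC].
    by move=> y Ay; have [By|By] := pselect (B y); [left|right].
  by apply: measureU2; [exact: measurableI|exact: measurableC].
apply: leeD; last by rewrite BC; exact: gaussian_tail_le.
apply: gaussian_tilt_le => //.
- by rewrite bj tnth_mktuple !inE eqxx add0r.
- by move=> i ij; rewrite !tnth_mktuple !inE ij.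
Qed.

Lemma minimax_FP_ge n (s : nat) (c1 e K mu : R) :
  (0 < s <= n)%N -> 0 <= c1 -> 0 < e -> 0 <= K ->
  0 < mu -> mu ^+ 2 = (c1 + e) * ln (n%:R / s%:R) ->
  (((n - s.-1)%:R * ((e / (c1 + e) - expR (- (K ^+ 2 / 2))) *
     expR (- (mu ^+ 2 / 2 + K * mu))))%:E <= minimax_FP n s c1)%E.
Proof.
move=> /andP[s0 sn] c0 e0 K0 mu_gt0; set L := ln _ => mu2.
have L0 : 0 < L.
  by rewrite -(@pmulr_rgt0 _ (c1 + e)) -?mu2 ?exprn_gt0//; lra.
set C := expR (mu ^+ 2 / 2 + K * mu); set tau := expR (- (K ^+ 2 / 2)).
have C0 : 0 < C by exact: expR_gt0.
rewrite expRN -/C; set eta := e / (c1 + e).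
apply: le_ereal_inf_tmp => _ [f [mf hf] <-].
have mA j : measurable [set y | tnth (f y) j != 0] by exact: measurable_tnth_neq0.
pose q (S : {set 'I_n}) j := fine (gaussian (spike mu S) [set y | tnth (f y) j != 0]).
have qE S j : gaussian (spike mu S) [set y | tnth (f y) j != 0] = (q S j)%:E.
  by rewrite /q fineK// fin_num_measure.
(* With [Q] the expected number of detected spikes, the risk bound reads
   [(c1 + e) * L * (s - Q) <= c1 * s * L]; cancelling [L] leaves [Q >= s * eta]. *)
have power (S : {set 'I_n}) : #|S| = s -> s%:R * eta <= \sum_(j in S) q S j.
  move=> Ss.
  have : (\sum_(j in S) (mu ^+ 2)%:E * (1 - q S j)%:E <= (c1 * s%:R * L)%:E)%E.
    apply: le_trans hf; apply: (@le_trans _ _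
      ('E_(gaussian (spike mu S))[fun y => sqdist (spike mu S) (f y)])%E).
      apply: le_trans (expectation_sqdist_ge _ mu S _ mf).
      by apply: lee_sum => j _; rewrite probability_setC// qE.
    apply: ereal_sup_ubound; exists (spike mu S) => //.
    by apply: spike_sparse; rewrite Ss.
  under eq_bigr do rewrite -EFinM.
  rewrite sumEFin lee_fin -mulr_sumr sumrB sumr_const Ss.
  set Q := \sum_(j in S) _ => h.
  have ce : 0 < c1 + e by lra.
  rewrite /eta mulrA ler_pdivrMr//.
  rewrite mu2 in h.
  have : L * ((c1 + e) * (s%:R - Q)) <= L * (c1 * s%:R) by lra.
  by rewrite ler_pM2l//; lra.
(* Each of the [s] detections loses [tau] to the tail and a factor [C] to the tilt. The resulting
   support [T] has size [s.-1], which explains [n - s.-1]. *)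
have [||T Ts hT] := @exists_sum_setC_ge R n s.-1 q ((eta - tau) / C).
- by rewrite prednK.
- move=> S; rewrite prednK// => Ss; rewrite mulrA ler_pdivrMr//.
  have := power S Ss.
  have : \sum_(j in S) q S j <= \sum_(j in S) (C * q (S :\ j)%SET j + tau).
    apply: ler_sum => j jS; rewrite -lee_fin -qE EFinD EFinM -qE.
    by apply: spike_power_le => //; exact: ltW.
  rewrite big_split/= -mulr_sumr sumr_const Ss -[tau *+ s]mulr_natl; lra.
apply: (@le_trans _ _ (\sum_(j | j \notin T) q T j)%:E); first by rewrite lee_fin.
apply: (@le_trans _ _ ('E_(gaussian (spike mu T))[fun y => (FP (spike mu T) (f y))%:R%R])%E).
  rewrite expectation_FP// -sumEFin; under eq_bigr do rewrite -qE.
  rewrite [leRHS](eq_bigl (fun j => j \notin T))// => j.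
  by rewrite tnth_mktuple; case: ifP => _; rewrite ?eqxx// gt_eqF.
apply: ereal_sup_ubound; exists (spike mu T) => //.
by apply: spike_sparse; rewrite Ts leq_pred.
Qed.

End lower_bound.

(** * From eventual bounds to asymptotic equivalence *)

Lemma limn_esup_le_near {R : realType} (u : (\bar R)^nat) (l : \bar R) :
  (\forall n \near \oo, (u n <= l)%E) -> (limn_esup u <= l)%E.
Proof.
move=> ul; apply: (@le_trans _ _ (ereal_sup (u @` [set n | (u n <= l)%E]))).
  (* The upper limit is an infimum over sets of the filter, and the set where the bound holds is one
     of them. *)
  by apply: ereal_inf_lbound; exists [set n | (u n <= l)%E].
by apply: ge_ereal_sup => _ [n /= un <-].
Qed.

Lemma limn_einf_ge_near {R : realType} (u : (\bar R)^nat) (l : \bar R) :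
  (\forall n \near \oo, (l <= u n)%E) -> (l <= limn_einf u)%E.
Proof.
move=> lu; rewrite /limn_einf leeNr; apply: limn_esup_le_near.
by apply: filterS lu => n; rewrite leeN2.
Qed.

Lemma asymp_equiv_near {R : realType} (a : nat -> \bar R) (b : nat -> R) (c C : R) :
  0 < c -> (\forall n \near \oo, 0 < b n /\
    ((c * b n)%:E <= a n)%E /\ (a n <= (C * b n)%:E)%E) ->
  asymp_equiv a b.
Proof.
move=> c0 ab; split.
  apply: (@lt_le_trans _ _ c%:E); first by rewrite lte_fin.
  apply: limn_einf_ge_near; apply: filterS ab => n [b0 [cb _]].
  by rewrite lee_pdivlMr// -EFinM.
apply: (@le_lt_trans _ _ C%:E); last exact: ltry.
apply: limn_esup_le_near; apply: filterS ab => n [b0 [_ Cb]].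
by rewrite lee_pdivrMr// -EFinM.
Qed.

Lemma minimax_FP_le_dim {R : realType} n (s : nat) (c1 : R) :
  Omega_o n s c1 !=set0 -> (minimax_FP n s c1 <= n%:R%:E)%E.
Proof.
move=> [f Of]; apply: (@le_trans _ _ (max_FP s f)).
  by apply: ereal_inf_lbound; exists f.
apply: ge_ereal_sup => _ [b _ <-]; rewrite expectation_FP; last by case: Of.
apply: (@le_trans _ _ (\sum_(j < n) 1%:E)%E).
  rewrite big_mkcond/=; apply: lee_sum => j _; case: ifP => _; last by rewrite lee_fin.
  by apply: probability_le1; apply: measurable_tnth_neq0; case: Of.
by rewrite sumEFin sumr_const card_ord.
Qed.

Lemma gaussian_tail_small {R : realType} (x : R) : 0 < x ->
  exists2 K : R, 0 <= K & expR (- (K ^+ 2 / 2)) <= x.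
Proof.
(* The absolute value covers [1 < x], where [ln x] is positive. *)
move=> x0; exists (Num.sqrt (2 * `|ln x|)); first exact: sqrtr_ge0.
rewrite sqr_sqrtr ?mulr_ge0// -[leRHS]lnK// ler_expR mulrAC divff// mul1r.
by rewrite lerNl -normrN ler_norm.
Qed.

(** * Rates along the sequence in the two regimes *)

Definition sparsity {R : realType} (s : nat -> nat) (n : nat) : R :=
  (s n)%:R / n%:R.

Section rates.
Context {R : realType} {s : nat -> nat} {c1 : R}.
Context (s_bounds : forall n : nat, (0 < n)%N -> (1 <= s n <= n)%N).

Local Notation p := (@sparsity R s).

Let p_gt0 n : (0 < n)%N -> 0 < p n.
Proof.
by move=> n0; have /andP[s1 _] := s_bounds n n0; rewrite divr_gt0 ?ltr0n.
Qed.

Let ln_ratio n : (0 < n)%N -> ln (n%:R / (s n)%:R) = - ln (p n) :> R.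
Proof.
move=> n0; have := p_gt0 n n0; rewrite /sparsity => p0.
by rewrite -[n%:R / _]invf_div lnV ?posrE.
Qed.

(** Serves both regimes. [K] is taken so large that the tail costs at most half of the detection
    rate [e / (c1 + e)]; [p n < 1] makes the spike height positive. *)
Lemma minimax_FP_ge_sparse (e K : R) n : (0 < n)%N -> 2 <= c1 -> 0 < e -> 0 <= K ->
  p n < 1 -> expR (- (K ^+ 2 / 2)) <= e / (c1 + e) / 2 ->
  ((n%:R * ((1 - p n) * (e / (c1 + e) / 2) *
    expR (- ((c1 + e) * - ln (p n) / 2 +
             K * Num.sqrt ((c1 + e) * - ln (p n))))))%:E <=
   minimax_FP n (s n) c1)%E.
Proof.
move=> n0 c1_ge2 e0 K0 p1 hK; have /andP[s1 sn] := s_bounds n n0.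
have L0 : 0 < - ln (p n) by rewrite oppr_gt0 ln_lt0// p_gt0.
set mu := Num.sqrt _.
have mu0 : 0 < mu by rewrite sqrtr_gt0 mulr_gt0//; lra.
have mu2 : mu ^+ 2 = (c1 + e) * - ln (p n).
  by rewrite sqr_sqrtr// mulr_ge0 ?(ltW L0)//; lra.
rewrite -mu2; apply: (le_trans _ (@minimax_FP_ge R n (s n) c1 e K mu _ _ e0 K0 mu0 _)).
- rewrite lee_fin mulrA mulrA [leRHS]mulrA ler_wpM2r ?expR_ge0//.
  have eta0 : 0 <= e / (c1 + e) / 2 by rewrite !divr_ge0//; lra.
  have h1 : n%:R * (1 - p n) <= (n - (s n).-1)%:R :> R.
    rewrite mulrBr mulr1 /sparsity mulrCA divff ?pnatr_eq0 -?lt0n// mulr1.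
    by rewrite -natrB// ler_nat leq_sub2l// leq_pred.
  apply: (@le_trans _ _ ((n - (s n).-1)%:R * (e / (c1 + e) / 2))).
    exact: ler_wpM2r.
  by apply: ler_wpM2l => //; lra.
- by rewrite s1.
- by lra.
- by rewrite mu2 ln_ratio.
Qed.

Lemma minimax_FP_asymp_dense (l : R) :
  2 <= c1 -> 0 < l < 1 -> p @ \oo --> l ->
  (\forall n \near \oo, Omega_o n (s n) c1 !=set0) ->
  asymp_equiv (fun n => minimax_FP n (s n) c1) (fun n => n%:R).
Proof.
move=> c1_ge2 /andP[l0 l1] pl On.
have [K K0 hK] := @gaussian_tail_small R (1 / (c1 + 1) / 2) ltac:(rewrite !divr_gt0//; lra).
(* The excess is [e = 1]. Eventually [l / 2 < p n < (1 + l) / 2], so [B] bounds [mu ^+ 2], and [c]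
   is the lower bound at these extremes. *)
set B := (c1 + 1) * - ln (l / 2).
set c := (1 - (1 + l) / 2) * (1 / (c1 + 1) / 2) * expR (- (B / 2 + K * Num.sqrt B)).
apply: (@asymp_equiv_near _ _ _ c 1).
  by rewrite !mulr_gt0 ?expR_gt0 ?invr_gt0//; lra.
have pl2 : \forall n \near \oo, p n < (1 + l) / 2 by apply: (cvgr_lt l) => //; lra.
have pl1 : \forall n \near \oo, l / 2 < p n by apply: (cvgr_gt l) => //; lra.
near=> n.
have n0 : (0 < n)%N by near: n; exact: nbhs_infty_gt.
have pn1 : l / 2 < p n by near: n.
have pn2 : p n < (1 + l) / 2 by near: n.
split; first by rewrite ltr0n.
split; last by rewrite mul1r; apply: minimax_FP_le_dim; near: n.
apply: le_trans (@minimax_FP_ge_sparse 1 K n n0 c1_ge2 ltr01 K0 _ hK); last by lra.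
have LB : (c1 + 1) * - ln (p n) <= B.
  rewrite ler_wpM2l//; first lra.
  by rewrite lerN2 ler_ln ?posrE ?p_gt0// ?ltW//; lra.
rewrite lee_fin mulrC ler_wpM2l//; apply: ler_pM.
- by rewrite !mulr_ge0 ?invr_ge0//; lra.
- exact: expR_ge0.
- by rewrite ler_wpM2r//; [rewrite !mulr_ge0 ?invr_ge0//; lra|lra].
- rewrite ler_expR lerN2 lerD//; first by lra.
  by rewrite ler_wpM2l// ler_wsqrtr.
Unshelve. all: by end_near. Qed.

(** [delta n] is chosen so that the claimed rate eventually equals the minimax value. What remains
    is [delta n --> 0]: the upper bound has exponent [c1 / 2], and the lower bounds have exponent
    [(c1 + e) / 2] for every [e > 0]. *)
Lemma minimax_FP_asymp_sparse : 2 <= c1 -> p @ \oo --> (0 : R) ->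
  exists delta : nat -> R, delta @ \oo --> (0 : R) /\
    asymp_equiv (fun n => minimax_FP n (s n) c1)
      (fun n => n%:R * p n `^ ((c1 + delta n) / 2)).
Proof.
move=> c1_ge2 p0.
have n_gt0 : \forall n \near \oo, (0 < n)%N by exact: nbhs_infty_gt.
have Ly (B : R) : \forall n \near \oo, B <= - ln (p n).
  have : \forall n \near \oo, p n < expR (- B).
    by apply: (cvgr_lt 0) => //; exact: expR_gt0.
  apply: filterS2 n_gt0 => n n0 pB.
  by rewrite lerNr -[leRHS]expRK ler_ln ?posrE ?p_gt0 ?expR_gt0// ltW.
pose r n := fine (minimax_FP n (s n) c1).
pose U : R := 2 * expR 10.
have upper : \forall n \near \oo, (minimax_FP n (s n) c1 <=
    (n%:R * (U * expR (c1 / 2 * ln (p n))))%:E)%E.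
  apply: filterS2 n_gt0 (Ly (4 * expR 10 + 20)) => n n0 hL.
  have e1 : 0 < expR 10 :> R by exact: expR_gt0.
  have := @minimax_FP_le R n (s n) c1 (s_bounds n n0) c1_ge2.
  rewrite ln_ratio// -/(p n) /powR ifF; last first.
    by apply/negP; rewrite gt_eqF// p_gt0.
  by rewrite -/U [U * _]mulrCA; apply; nra.
have lower (e : R) : 0 < e -> exists2 W : R, 0 < W & \forall n \near \oo,
    ((n%:R * (W * expR ((c1 + e) / 2 * ln (p n))))%:E <= minimax_FP n (s n) c1)%E.
  (* Half of the excess [e] goes into the spike height, the other half absorbs the term of order
     [sqrt L]. *)
  move=> e0; pose e' := e / 2; have e'0 : 0 < e' by rewrite /e'; lra.
  have eta0 : 0 < e' / (c1 + e') / 2 by rewrite !divr_gt0//; lra.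
  have [K K0 hK] := @gaussian_tail_small R _ eta0.
  exists (1 / 2 * (e' / (c1 + e') / 2)); first by rewrite mulr_gt0.
  have half : \forall n \near \oo, p n < 1 / 2 by apply: (cvgr_lt 0) => //; lra.
  (* This threshold on [L = - ln (p n)] is what [K * sqrt ((c1 + e') * L) <= e / 4 * L] becomes
     after squaring. *)
  apply: filterS3 n_gt0 half (Ly (16 * K ^+ 2 * (c1 + e') / e ^+ 2)) => n n0 ph hL.
  apply: le_trans (@minimax_FP_ge_sparse e' K n n0 c1_ge2 e'0 K0 _ hK); last by lra.
  rewrite lee_fin ler_wpM2l//; apply: ler_pM.
  - by rewrite mulr_ge0// ltW.
  - exact: expR_ge0.
  - by rewrite ler_wpM2r//; [exact: ltW|lra].
  rewrite ler_expR; set L := - ln (p n).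
  have L0 : 0 < L by rewrite /L oppr_gt0 ln_lt0// p_gt0//; lra.
  rewrite -[ln (p n)]opprK -/L.
  have : K * Num.sqrt ((c1 + e') * L) <= e / 4 * L.
    rewrite -(@ler_pXn2r _ 2) ?nnegrE//; first last.
    + by rewrite mulr_ge0 ?ltW//; lra.
    + by rewrite mulr_ge0 ?sqrtr_ge0.
    rewrite exprMn sqr_sqrtr; last by rewrite mulr_ge0 ?ltW//; lra.
    move: hL; rewrite -/L ler_pdivrMr ?exprn_gt0// => hL.
    have := ler_wpM2r (ltW L0) hL; lra.
  rewrite /e'; lra.
have rP : \forall n \near \oo, minimax_FP n (s n) c1 = (r n)%:E /\ 0 < r n.
  have [W W0 low] := lower 1 ltr01.
  apply: filterS3 n_gt0 low upper => n n0 lown upn.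
  have rE : minimax_FP n (s n) c1 = (r n)%:E.
    rewrite /r fineK// fin_numE -ltNye -ltey.
    by rewrite (lt_le_trans _ lown) ?ltNyr// (le_lt_trans upn) ?ltry.
  split => //; rewrite -lte_fin -rE (lt_le_trans _ lown)// lte_fin.
  by rewrite !mulr_gt0 ?expR_gt0 ?ltr0n.
exists (fun n => 2 * (ln (r n / n%:R) / ln (p n)) - c1); split.
  apply/cvgrPdist_le => e e0.
  have e20 : 0 < e / 2 by lra.
  have [W W0 low] := lower _ e20.
  have U0 : 0 < U by rewrite mulr_gt0 ?expR_gt0.
  near=> n.
  have n0 : (0 < n)%N by near: n.
  have nR : 0 < n%:R :> R by rewrite ltr0n.
  have [rE r0] : minimax_FP n (s n) c1 = (r n)%:E /\ 0 < r n by near: n.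
  have rn0 : 0 < r n / n%:R by rewrite divr_gt0.
  have L1 : 1 <= - ln (p n) by near: n; exact: Ly.
  (* These two thresholds absorb the constants: the upper bound then gives [- e <= d], and the lower
     bound at excess [e / 2] gives [d <= e]. *)
  have LU : 2 * ln U / e <= - ln (p n) by near: n; exact: Ly.
  have LW : - 4 * ln W / e <= - ln (p n) by near: n; exact: Ly.
  rewrite ler_pdivrMr// in LU; rewrite ler_pdivrMr// in LW.
  have lnWU (V a : R) : 0 < V -> ln (V * expR (a / 2 * ln (p n))) = ln V + a / 2 * ln (p n).
    by move=> V0; rewrite lnM ?posrE ?expR_gt0// expRK.
  have lown : ln W + (c1 + e / 2) / 2 * ln (p n) <= ln (r n / n%:R).
    rewrite -lnWU// ler_ln ?posrE// ?mulr_gt0 ?expR_gt0//.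
    by rewrite ler_pdivlMr// mulrC -lee_fin -rE; near: n.
  have upn : ln (r n / n%:R) <= ln U + c1 / 2 * ln (p n).
    rewrite -lnWU// ler_ln ?posrE// ?mulr_gt0 ?expR_gt0//.
    by rewrite ler_pdivrMr// mulrC -lee_fin -rE; near: n.
  set d := 2 * _ - c1.
  have dE : d * - ln (p n) = c1 * ln (p n) - 2 * ln (r n / n%:R).
    by rewrite /d; field; lra.
  have L0 : 0 < - ln (p n) by lra.
  rewrite sub0r normrN ler_norml; apply/andP; split.
    by rewrite -(ler_pM2r L0) dE; lra.
  by rewrite -(ler_pM2r L0) dE; lra.
apply: (@asymp_equiv_near _ _ _ 1 1) => //.
apply: filterS3 n_gt0 rP (Ly 1) => n n0 [rE r0] L1.
have nR : 0 < n%:R :> R by rewrite ltr0n.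
have -> : n%:R * p n `^ ((c1 + (2 * (ln (r n / n%:R) / ln (p n)) - c1)) / 2) = r n.
  rewrite /powR ifF; last by apply/negP; rewrite gt_eqF// p_gt0.
  rewrite (_ : _ / 2 * _ = ln (r n / n%:R)); last by field; lra.
  by rewrite lnK ?posrE ?divr_gt0// mulrC divfK// gt_eqF.
by rewrite rE mul1r lexx.
Unshelve. all: by end_near. Qed.

End rates.

Theorem corollary2p1 (R : realType) (s : nat -> nat) (zeta c1 : R)
  (s_bounds : forall n : nat, (0 < n)%N -> (1 <= s n <= n)%N)
  (zeta_bounds : 0 <= zeta < 1)
  (s_limsup : limn_esup (fun n : nat => ((s n)%:R / n%:R : R)%:E) = zeta%:E)
  (c1_ge2 : 2 <= c1)
  (Omega_nonempty : \forall n \near \oo, Omega_o n (s n) c1 !=set0) :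
  (forall l : R, 0 < l ->
     (fun n : nat => (s n)%:R / n%:R : R) @ \oo --> l ->
     asymp_equiv (fun n : nat => minimax_FP n (s n) c1) (fun n : nat => n%:R))
  /\
  ((fun n : nat => (s n)%:R / n%:R : R) @ \oo --> (0 : R) ->
     exists delta : nat -> R,
       delta @ \oo --> (0 : R) /\
       asymp_equiv (fun n : nat => minimax_FP n (s n) c1)
         (fun n : nat =>
            n%:R * ((s n)%:R / n%:R) `^ ((c1 + delta n) / 2))).
Proof.
split=> [l l0 pl|p0]; last exact: minimax_FP_asymp_sparse.
apply: (minimax_FP_asymp_dense s_bounds l) => //.
(* The limit of a convergent sequence is its upper limit, so [l < 1] follows from [zeta < 1]. *)
suff lz : l = zeta by rewrite l0/= lz; case/andP: zeta_bounds.
apply: EFin_inj; rewrite -s_limsup; apply/esym.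
have pl' : ((s n)%:R / n%:R : R)%:E @[n --> \oo] --> l%:E.
  by apply: cvg_EFin => //; exact: nearW.
by have [_ ->] := cvg_limn_einf_sup pl'.
Qed.
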